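(* Let $X$ be a separable real Banach space. Then $X$ is isomorphic (linearly homeomorphic) to a Hilbert space if and only if there exist a sequence $\{x_n\}$ in $X$ and a bounded linear operator $S:X\to X^*$ such that $\{x_n\}$ is a Hilbert-Schauder frame of $X$ with Hilbert-Schauder frame operator $S$, and such that the sequence $\{Sx_n\}$ is a Hilbert-Schauder frame of the Banach space $\overline{\mathrm{span}}\{Sx_n\}$, the norm closure in $X^*$ of the linear span of $\{Sx_n\}$.
   Context: All Banach and Hilbert spaces are over the real scalars; sequences are indexed by $\mathbb{N}$ or by a finite initial segment of $\mathbb{N}$. For a Banach space $Z$, a sequence of pairs $\{z_n,g_n\}$ in $Z\times Z^*$ is a Schauder frame of $Z$ if $z=\sum_n g_n(z)z_n$ (norm convergence, in the given order) for every $z\in Z$. A Schauder frame $\{z_n,g_n\}$ of a separable Banach space $Z$ is a Hilbert-Schauder frame (HS-frame) if there is a bounded linear operator $T:Z\to Z^*$ with $T(z_n)=g_n$ for all $n$; $T$ is then a Hilbert-Schauder frame operator. A single sequence $\{z_n\}$ in $Z$ is called a Hilbert-Schauder frame of $Z$ with Hilbert-Schauder frame operator $T$ if $T:Z\to Z^*$ is bounded linear and $\{z_n,Tz_n\}$ is a Schauder frame of $Z$; $\{z_n\}$ is called a Hilbert-Schauder frame of $Z$ if such an operator $T$ exists. *)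

(* Defs.v *)
From HB Require Import structures.
From mathcomp Require Import all_boot all_order all_algebra.
From mathcomp Require Import all_classical all_reals all_analysis.

Set Implicit Arguments.
Unset Strict Implicit.
Unset Printing Implicit Defensive.

Import Order.TTheory GRing.Theory Num.Theory.
Import numFieldNormedType.Exports.

Local Open Scope classical_set_scope.
Local Open Scope ring_scope.

Section dual.
Context {R : realType} {X : normedModType R}.

Definition dual_pred : {pred X -> R^o} :=
  [pred f | `[< linear (f : X -> R^o) /\ continuous (f : X -> R^o) >]].

Fact dual_submod_closed : submod_closed dual_pred.
Proof.
split=> [|a f g /asboolP[lf cf] /asboolP[lg cg]]; apply/asboolP; split.
- by move=> a x y /=; rewrite scaler0 addr0.
- exact: cst_continuous.
- move=> b x y; rewrite !fctE lf lg; rewrite !scalerDr !scalerA (mulrC a b).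
  by rewrite addrACA.
- by move=> x; apply: cvgD; [apply: cvgZr; exact: cf|exact: cg].
Qed.

HB.instance Definition _ :=
  GRing.isSubmodClosed.Build R (X -> R^o) dual_pred dual_submod_closed.

End dual.

Record dual (R : realType) (X : normedModType R) := Dual {
  dual_fun :> X -> R^o;
  dual_funP : dual_fun \in dual_pred
}.

HB.instance Definition _ (R : realType) (X : normedModType R) :=
  [isSub for @dual_fun R X].
HB.instance Definition _ (R : realType) (X : normedModType R) :=
  [Choice of dual X by <:].
HB.instance Definition _ (R : realType) (X : normedModType R) :=
  [SubChoice_isSubLmodule of dual X by <:].

Section dual_norm.
Context {R : realType} {X : normedModType R}.
Implicit Types (f g : dual X) (x y : X).

Lemma dual_linear f : linear f.
Proof. by have /asboolP[] := dual_funP f. Qed.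

Lemma dual_continuous f : continuous f.
Proof. by have /asboolP[] := dual_funP f. Qed.

HB.instance Definition _ f :=
  GRing.isLinear.Build R X R^o _ f (@dual_linear f).

Lemma dualDE f g x : (f + g) x = f x + g x. Proof. by []. Qed.
Lemma dualNE f x : (- f) x = - f x. Proof. by []. Qed.
Lemma dualZE (a : R) f x : (a *: f) x = a * f x. Proof. by []. Qed.
Lemma dualP f g : f =1 g -> f = g.
Proof. by move=> fg; apply: val_inj; apply/funext. Qed.

Definition dual_norm f : R := sup [set `|f x| | x in [set x : X | `|x| <= 1]].

Lemma dual_bounded f : exists2 M : R, 0 <= M & forall x, `|f x| <= M * `|x|.
Proof.
have /linear_boundedP /pinfty_ex_gt0[M M0 fM] : bounded_near f (nbhs 0).
  by apply/linear_bounded_continuous; exact: dual_continuous.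
by exists M => //; exact: ltW.
Qed.

Let has_sup_norm f : has_sup [set `|f x| | x in [set x : X | `|x| <= 1]].
Proof.
split; first by exists `|f 0|, 0 => //=; rewrite normr0.
have [M M0 fM] := dual_bounded f.
exists M => _ [x /= x1 <-]; rewrite (le_trans (fM x))//.
by rewrite -[leRHS]mulr1 ler_wpM2l.
Qed.

Lemma ler_dual_norm f x : `|f x| <= dual_norm f * `|x|.
Proof.
have [->|x0] := eqVneq x 0; first by rewrite linear0 !normr0 mulr0.
have nx0 : 0 < `|x| by rewrite normr_gt0.
rewrite -ler_pdivrMr//.
apply: sup_upper_bound => //; exists (`|x|^-1 *: x) => /=.
  by rewrite normrZ normfV normr_id mulVf// normr_eq0.
by rewrite linearZ/= normrZ normfV normr_id mulrC.
Qed.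

Lemma dual_norm_le f (M : R) :
  0 <= M -> (forall x, `|f x| <= M * `|x|) -> dual_norm f <= M.
Proof.
move=> M0 fM; apply: ge_sup; first by case: (has_sup_norm f).
move=> _ [x /= x1 <-]; rewrite (le_trans (fM x))//.
by rewrite -[leRHS]mulr1 ler_wpM2l.
Qed.

Lemma dual_norm_ge0 f : 0 <= dual_norm f.
Proof.
apply: (le_trans (normr_ge0 (f 0))).
by apply: sup_upper_bound => //; exists 0 => //=; rewrite normr0.
Qed.

Fact dual_normD f g : dual_norm (f + g) <= dual_norm f + dual_norm g.
Proof.
apply: dual_norm_le => [|x]; first by rewrite addr_ge0 ?dual_norm_ge0.
by rewrite dualDE (le_trans (ler_normD _ _))// mulrDl lerD ?ler_dual_norm.
Qed.

Fact dual_normZ (a : R) f : dual_norm (a *: f) = `|a| * dual_norm f.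
Proof.
have le (b : R) (g : dual X) : dual_norm (b *: g) <= `|b| * dual_norm g.
  apply: dual_norm_le => [|x]; first by rewrite mulr_ge0 ?dual_norm_ge0.
  by rewrite dualZE normrM -mulrA ler_wpM2l// ler_dual_norm.
apply/eqP; rewrite eq_le le/=.
have [->|a0] := eqVneq a 0; first by rewrite normr0 mul0r dual_norm_ge0.
rewrite -ler_pdivlMl ?normr_gt0// -normfV.
by rewrite -[in leLHS](scalerK a0 f) le.
Qed.

Fact dual_norm0_eq0 f : dual_norm f = 0 -> f = 0.
Proof.
move=> f0; apply: dualP => x; apply/eqP; rewrite -normr_le0.
by rewrite (le_trans (ler_dual_norm f x))// f0 mul0r.
Qed.

HB.instance Definition _ := Lmodule_isNormed.Build R (dual X)
  dual_normD dual_normZ dual_norm0_eq0.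

Lemma dual_normE f : `|f| = dual_norm f. Proof. by []. Qed.

Fact dual_complete (F : set_system (dual X)) :
  ProperFilter F -> cauchy F -> cvg F.
Proof.
move=> FF /cauchyP Fc.
have ballE f (e : R) g : ball f e g -> forall x, `|f x - g x| <= e * `|x|.
  rewrite -ball_normE /= => fg x.
  rewrite -[f x - g x]/((f - g) x) (le_trans (ler_dual_norm _ _))//.
  by rewrite ler_wpM2r// ltW.
have cvgx x : cvg ((fun g : dual X => g x : R^o) @ F).
  apply: R_complete; apply/cauchyP => e e0.
  have x0 : 0 < `|x| + 1 by rewrite ltr_wpDl.
  have [f Ff] := Fc (e / (`|x| + 1)) (divr_gt0 e0 x0).
  exists (f x); rewrite /=; near=> g.
  have /ballE/(_ x) fg : ball f (e / (`|x| + 1)) g by near: g; exact: Ff.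
  rewrite /= /ball/= (le_lt_trans fg)//.
  by rewrite mulrAC ltr_pdivrMr// ltr_pM2l// ltrDl.
pose l x : R^o := lim ((fun g : dual X => g x : R^o) @ F).
have lP x : (fun g : dual X => g x : R^o) @ F --> l x by exact: cvgx.
have lball f (e : R) : F (ball f e) -> forall x, `|f x - l x| <= e * `|x|.
  move=> Ff x; have fgl : (fun g : dual X => `|f x - g x|) @ F --> `|f x - l x|.
    by apply: cvg_norm; apply: cvgB; [exact: cvg_cst|exact: lP].
  rewrite -(cvg_lim _ fgl)//; apply: limr_le; first by apply/cvg_ex; eexists; exact: fgl.
  near=> g; have /ballE/(_ x)// : ball f e g by near: g; exact: Ff.
have linl : linear l.
  move=> a x y; apply: cvg_lim => //.
  rewrite (_ : (fun g : dual X => _) = (fun g => a *: (g x : R^o) + g y)).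
    by apply: cvgD; [apply: cvgZr; exact: lP|exact: lP].
  by apply/funext => g; rewrite linearP.
pose lL := GRing.isLinear.Build R X R^o _ l linl.
pose ll : {linear X -> R^o} := HB.pack l lL.
have contl : continuous l.
  have [f Ff] := Fc 1 ltr01.
  apply: (@bounded_linear_continuous _ _ _ ll); apply/linear_boundedP.
  near=> M => x; rewrite -[ll x]/(l x) -(subrK (f x) (l x)).
  rewrite (le_trans (ler_normD _ _))// -normrN opprB.
  rewrite (le_trans (lerD (lball _ _ Ff x) (ler_dual_norm f x)))//.
  rewrite -mulrDl ler_wpM2r//; near: M; apply: nbhs_pinfty_ge.
have lD : (l : X -> R^o) \in dual_pred by apply/asboolP.
apply/cvg_ex; exists (Dual lD); apply/cvgrPdist_le => /= e e0.
have e20 : 0 < e / 2 by rewrite divr_gt0.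
have [f Ff] := Fc _ e20; near=> g.
apply: dual_norm_le => [|x]; first exact: ltW.
rewrite dualDE dualNE /= -[_ - _](subrKA (f x)) (splitr e) mulrDl.
rewrite (le_trans (ler_normD _ _))// lerD//; first by rewrite distrC lball.
have /ballE/(_ x)// : ball f (e / 2) g by near: g; exact: Ff.
Unshelve. all: by end_near. Qed.

HB.instance Definition _ := Uniform_isComplete.Build (dual X) dual_complete.

End dual_norm.

Section closed_span.
Context {R : realType} {Z : normedModType R}.
Implicit Types A : set Z.

Definition linear_span A : set Z :=
  [set v | exists s : seq (R * Z),
    (forall p, p \in s -> A p.2) /\ v = \sum_(p <- s) p.1 *: p.2].

Definition closed_span_pred A : {pred Z} :=
  [pred v | v \in closure (linear_span A)].

Lemma linear_spanP A (a : R) (v w : Z) : linear_span A v -> linear_span A w ->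
  linear_span A (a *: v + w).
Proof.
move=> [s [sA ->]] [t [tA ->]].
exists ([seq (a * p.1, p.2) | p <- s] ++ t); split.
  by move=> p; rewrite mem_cat => /orP[/mapP[q /sA Aq ->]//|/tA].
rewrite big_cat big_map /= scaler_sumr; congr (_ + _).
by apply: eq_bigr => p _; rewrite scalerA.
Qed.

Lemma closure_normP A v : closure A v <->
  forall e : R, 0 < e -> exists2 w, A w & `|v - w| < e.
Proof.
split=> [Av e e0|Av B /nbhs_normP[e /= e0 vB]].
  by have [w [Aw]] := Av _ (nbhsx_ballx v e e0); rewrite -ball_normE; exists w.
by have [w Aw vw] := Av _ e0; exists w; split => //; exact: vB.
Qed.

Fact closed_span_submod_closed A : submod_closed (closed_span_pred A).
Proof.
split=> [|a v w]; rewrite !inE.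
  by apply: subset_closure; exists [::]; rewrite big_nil; split.
move=> /closure_normP Av /closure_normP Aw; apply/closure_normP => e e0.
have a0 : 0 < `|a| + 1 by rewrite ltr_wpDl.
have e20 : 0 < e / 2 by rewrite divr_gt0.
have [v' Av' vv'] := Av _ (divr_gt0 e20 a0); have [w' Aw' ww'] := Aw _ e20.
exists (a *: v' + w'); first exact: linear_spanP.
rewrite opprD addrACA -scalerBr (le_lt_trans (ler_normD _ _))// normrZ.
rewrite (splitr e) ler_ltD//.
move: vv'; rewrite ltr_pdivlMr// => /ltW; apply: le_trans.
by rewrite mulrC ler_wpM2l// lerDl.
Qed.

HB.instance Definition _ A := GRing.isSubmodClosed.Build R Z
  (closed_span_pred A) (closed_span_submod_closed A).

Record closed_span A := ClosedSpan {
  closed_span_val :> Z;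
  closed_span_valP : closed_span_val \in closed_span_pred A
}.

HB.instance Definition _ A := [isSub for @closed_span_val A].
HB.instance Definition _ A := [Choice of closed_span A by <:].
HB.instance Definition _ A := [SubChoice_isSubLmodule of closed_span A by <:].

Section closed_span_norm.
Variable A : set Z.
Implicit Types v w : closed_span A.

Let nm v : R := `|val v|.
Let nmD v w : nm (v + w) <= nm v + nm w. Proof. exact: ler_normD. Qed.
Let nmZ (a : R) v : nm (a *: v) = `|a| * nm v. Proof. exact: normrZ. Qed.
Let nm0 v : nm v = 0 -> v = 0.
Proof. by move=> /normr0_eq0 v0; exact: val_inj. Qed.

HB.instance Definition _ :=
  Lmodule_isNormed.Build R (closed_span A) nmD nmZ nm0.

Lemma closed_span_normE v : `|v| = `|val v|. Proof. by []. Qed.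

End closed_span_norm.

Lemma mem_closed_span I (z : I -> Z) i : z i \in closed_span_pred (range z).
Proof.
rewrite !inE; apply: subset_closure; exists [:: (1, z i)]; split.
  by move=> p; rewrite inE => /eqP ->; exists i.
by rewrite big_seq1 scale1r.
Qed.

Definition in_closed_span I (z : I -> Z) (i : I) : closed_span (range z) :=
  ClosedSpan (mem_closed_span z i).

End closed_span.

Section closed_span_complete.
Context {R : realType} {Z : completeNormedModType R} (A : set Z).

Fact closed_span_complete (F : set_system (closed_span A)) :
  ProperFilter F -> cauchy F -> cvg F.
Proof.
move=> FF /cauchyP Fc.
have /cvg_ex[l Fl] : cvg (val v @[v --> F]).
  apply: cauchy_cvg; apply/cauchyP => e e0.
  have [v Fv] := Fc e e0; exists (val v).
  by rewrite /=; apply: filterS Fv => w; rewrite -!ball_normE.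
have lA : l \in closed_span_pred A.
  rewrite !inE; apply: (closed_cvg _ _ _ _ Fl); first exact: closed_closure.
  by apply: nearW => v; have := closed_span_valP v; rewrite !inE.
apply/cvg_ex; exists (ClosedSpan lA); apply/cvgrPdist_le => /= e e0.
by move/cvgrPdist_le : Fl => /(_ e e0).
Qed.

HB.instance Definition _ :=
  Uniform_isComplete.Build (closed_span A) closed_span_complete.

End closed_span_complete.

(* A sequence in Z is a map [index_set N -> Z]: [N = None] gives sequences
   indexed by all of nat, [N = Some n] those indexed by {0, ..., n - 1}. *)
Definition index_set (N : option nat) : Type :=
  if N is Some n then 'I_n else nat.

Section frames.
Context {R : realType}.

Definition sums_to {Z : normedModType R} (N : option nat) :
    (index_set N -> Z) -> Z -> Prop :=
  match N with
  | Some n => fun u z => \sum_(i < n) u i = z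
  | None => fun u z => series u @ \oo --> z
  end.

Definition schauder_frame {Z : completeNormedModType R} (N : option nat)
    (z : index_set N -> Z) (g : index_set N -> dual Z) :=
  forall x : Z, sums_to (fun n => g n x *: z n) x.

Definition bounded_operator {V W : normedModType R} (T : V -> W) :=
  exists M : R, forall x, `|T x| <= M * `|x|.

Definition HS_frame_with {Z : completeNormedModType R} (N : option nat)
    (z : index_set N -> Z) (T : {linear Z -> dual Z}) :=
  bounded_operator T /\ schauder_frame z (T \o z).

Definition HS_frame {Z : completeNormedModType R} (N : option nat)
    (z : index_set N -> Z) :=
  exists T : {linear Z -> dual Z}, HS_frame_with z T.

End frames.

Definition separable (T : topologicalType) :=
  exists2 D : set T, countable D & dense D.

(* [{dot H for idfun}] is the type of real inner products: symmetric, bilinear,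
   positive definite forms. *)
Definition hilbert {R : realType} (H : completeNormedModType R) :=
  exists ip : {dot H for idfun}, forall x, `|x| ^+ 2 = ip x x.

Definition isomorphic {R : realType} (V W : normedModType R) :=
  exists (f : {linear V -> W}) (g : W -> V),
    [/\ cancel f g, cancel g f, continuous f & continuous g].

(* Main.v *)
(* If f : X -> H is an isomorphism onto a Hilbert space, then <f x, f y> is an
   inner product on X with an equivalent norm; an orthonormal sequence (e_n) for
   it with dense span is a frame of X for S x = <x, .>, and its image by S is a
   frame of the range of S for the inner product transported by S^-1.

   Conversely, expanding S x along the frame gives
   (S x)(w) = sum_n (S x_n)(x) (S x_n)(w), so S is symmetric and positive, and
   so is the frame operator T of the closed span Y of (S x_n). Expanding both w
   in X and v in Y yields (T v)(S w) = v(w). Let P_k be the partial sums of the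
   frame of X, uniformly bounded by Banach-Steinhaus. For phi in X^* the
   functional phi o P_k lies in Y, hence phi(P_k w) = T(phi o P_k)(S w) is bounded
   by a constant times |phi| |S w|; by Hahn-Banach |w| <= K |S w|. The
   Cauchy-Schwarz inequality for (S x)(w) gives |S w|^2 <= |S| (S w)(w), so
   (S x)(w) is an inner product whose norm is equivalent to that of X. *)

From HB Require Import structures.
Require Import Defs.
From mathcomp Require Import all_boot all_order all_algebra.
From mathcomp Require Import all_classical all_reals all_analysis.
From mathcomp Require Import ring lra.

Set Implicit Arguments.
Unset Strict Implicit.
Unset Printing Implicit Defensive.

Import Order.TTheory GRing.Theory Num.Theory.
Import numFieldNormedType.Exports.

Local Open Scope classical_set_scope.
Local Open Scope ring_scope.

(** * The Hahn-Banach theorem *)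

Section hahn_banach.
Context {R : realType} {V : lmodType R}.
Implicit Types (p q : V -> R) (x y : V).

Definition sublinear p :=
  (forall x y, p (x + y) <= p x + p y) /\
  (forall a x, 0 <= a -> p (a *: x) <= a * p x).

Lemma sublinear0 p : sublinear p -> p 0 = 0.
Proof.
move=> [pD pZ]; apply/eqP; rewrite eq_le; apply/andP; split.
  by have := pZ 0 0 (lexx _); rewrite scale0r mul0r.
by have := pD 0 0; rewrite addr0; lra.
Qed.

Lemma sublinearZ p a x : sublinear p -> 0 <= a -> p (a *: x) = a * p x.
Proof.
move=> sp; rewrite le_eqVlt => /predU1P[<-|a0].
  by rewrite scale0r sublinear0// mul0r.
apply/eqP; rewrite eq_le (sp.2 _ _ (ltW a0))/= -ler_pdivlMl//.
by rewrite -{1}(scalerK (lt0r_neq0 a0) x) sp.2// invr_ge0 ltW.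
Qed.

Lemma sublinear_ge p x : sublinear p -> - p (- x) <= p x.
Proof. by move=> sp; have := sp.1 x (- x); rewrite subrr sublinear0//; lra. Qed.

(** The value [t = 0] keeps the tilt below [p]; the value [t = 1] at the point [- y] pushes it down
    to [- p y]. A linear functional below the tilt therefore agrees with [p] at [y]. *)
Definition tilt p y x : R :=
  inf [set p (x + t *: y) - t * p y | t in [set t : R | 0 <= t]].

Let tilt_lb p y x : sublinear p ->
  lbound [set p (x + t *: y) - t * p y | t in [set t : R | 0 <= t]] (- p (- x)).
Proof.
move=> sp _ [t /= t0 <-].
have := sp.1 (x + t *: y) (- x).
by rewrite [x + _]addrC addrK (sublinearZ _ sp t0); lra.
Qed.

Lemma tilt_le p y x t : sublinear p -> 0 <= t ->
  tilt p y x <= p (x + t *: y) - t * p y.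
Proof.
by move=> sp t0; apply: ge_inf; [exists (- p (- x)); exact: tilt_lb|exists t].
Qed.

Lemma le_tilt p y x b :
  (forall t, 0 <= t -> b <= p (x + t *: y) - t * p y) -> b <= tilt p y x.
Proof.
move=> H; apply: lb_le_inf; first by exists (p (x + 0 *: y) - 0 * p y), 0 => /=.
by move=> _ [t /= t0 <-]; exact: H.
Qed.

Lemma tilt_le_self p y x : sublinear p -> tilt p y x <= p x.
Proof.
move=> sp; have := tilt_le y x sp (lexx 0).
by rewrite scale0r mul0r addr0 subr0.
Qed.

Lemma tiltN_le p y : sublinear p -> tilt p y (- y) <= - p y.
Proof.
move=> sp; have := tilt_le y (- y) sp ler01.
by rewrite scale1r addNr mul1r sublinear0// sub0r.
Qed.

(** Parameters [t] and [s] chosen for two summands combine into [t + s] for their sum, and scaling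
    by [a] turns [t] into [a * t]. *)
Lemma tilt_sublinear p y : sublinear p -> sublinear (tilt p y).
Proof.
move=> sp; split=> [x1 x2|a x a0].
  rewrite -lerBlDr; apply: le_tilt => t t0.
  rewrite lerBlDr -lerBlDl; apply: le_tilt => s s0; rewrite lerBlDl.
  apply: (le_trans (tilt_le y (x1 + x2) sp (addr_ge0 t0 s0))).
  rewrite scalerDl addrACA; have := sp.1 (x1 + t *: y) (x2 + s *: y); lra.
move: a0; rewrite le_eqVlt => /predU1P[<-|a0].
  by rewrite scale0r mul0r (le_trans (tilt_le_self _ _ sp))// sublinear0.
rewrite -ler_pdivrMl//; apply: le_tilt => t t0; rewrite ler_pdivrMl//.
apply: (le_trans (tilt_le y (a *: x) sp (mulr_ge0 (ltW a0) t0))).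
by rewrite -scalerA -scalerDr (sublinearZ _ sp (ltW a0)) mulrBr mulrA.
Qed.

(* A minimal sublinear functional coincides with all its tilts; comparing the
   values at [- y] of the two sides makes it odd, hence linear. *)
Lemma minimal_sublinear_linear p : sublinear p ->
  (forall q, sublinear q -> (forall x, q x <= p x) -> q = p) ->
  linear (p : V -> R^o).
Proof.
move=> sp pmin.
have pN y : p (- y) = - p y.
  apply/eqP; rewrite eq_le; apply/andP; split.
    have := tiltN_le y sp; rewrite (_ : tilt p y = p)//.
    by apply: pmin => [|x]; [exact: tilt_sublinear|exact: tilt_le_self].
  by rewrite -[in leLHS](opprK y) sublinear_ge.
have pD x y : p (x + y) = p x + p y.
  apply/eqP; rewrite eq_le sp.1/=.
  by have := sp.1 (- x) (- y); rewrite -opprD !pN; lra.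
move=> a x y; rewrite pD; congr (_ + _).
have [a0|/ltW a0] := leP 0 a; first exact: sublinearZ.
by rewrite -[a in LHS]opprK scaleNr pN sublinearZ ?oppr_ge0// mulNr opprK.
Qed.

Lemma minimal_sublinear_ex p : sublinear p -> exists q, [/\ sublinear q,
  forall x, q x <= p x &
  forall q', sublinear q' -> (forall x, q' x <= q x) -> q' = q].
Proof.
move=> sp.
pose T := {q : V -> R | sublinear q /\ forall x, q x <= p x}.
(* The order is reversed: a maximal element for Zorn's lemma is a minimal functional. *)
pose ge (q q' : T) := `[< forall x, sval q' x <= sval q x >].
have [| | | |[q [sq qp]] qmin] := @Zorn T ge.
- by move=> q; apply/asboolP => x.
- move=> q r s /asboolP h1 /asboolP h2; apply/asboolP => x.
  exact: le_trans (h2 x) (h1 x).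
- move=> [q hq] [r hr] /asboolP/= h1 /asboolP/= h2; apply: eq_exist.
  by apply/funext => x; apply/eqP; rewrite eq_le h1 h2.
- move=> A Atot.
  have [[q0 Aq0]|A0] := pselect (exists q0 : T, A q0); last first.
    (* The empty chain is bounded by [p] itself. *)
    exists (exist _ p (conj sp (fun x => lexx _))) => s As.
    by case: A0; exists s.
  pose B x := [set sval q x | q in A].
  have Blb x : lbound (B x) (- p (- x)).
    move=> _ [[q [sq qp]] /= Aq <-].
    by rewrite (le_trans _ (sublinear_ge x sq))// lerN2.
  have infB_le x (q : T) : A q -> inf (B x) <= sval q x.
    by move=> Aq; apply: ge_inf; [exists (- p (- x))|exists q].
  have le_infB x b : (forall q : T, A q -> b <= sval q x) -> b <= inf (B x).
    move=> H; apply: lb_le_inf; first by exists (sval q0 x), q0.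
    by move=> _ [q Aq <-]; exact: H.
  have sB : sublinear (fun x => inf (B x)).
    split=> [x y|a x a0].
      rewrite -lerBlDr; apply: (le_infB) => q Aq.
      rewrite lerBlDr -lerBlDl; apply: (le_infB) => r Ar; rewrite lerBlDl.
      (* In a chain, the smaller of [q] and [r] serves for both summands. *)
      have [/asboolP h|/asboolP h] := Atot _ _ Aq Ar.
        apply: (le_trans (infB_le _ _ Ar)).
        apply: (le_trans ((svalP r).1.1 x y)).
        exact: lerD.
      apply: (le_trans (infB_le _ _ Aq)).
      apply: (le_trans ((svalP q).1.1 x y)).
      exact: lerD.
    move: a0; rewrite le_eqVlt => /predU1P[<-|a0].
      rewrite scale0r mul0r (le_trans (infB_le _ _ Aq0))// sublinear0//.
      by case: (svalP q0).
    rewrite -ler_pdivrMl//; apply: (le_infB) => q Aq; rewrite ler_pdivrMl//.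
    by rewrite (le_trans (infB_le _ _ Aq))// (svalP q).1.2// ltW.
  have Bp x : inf (B x) <= p x.
    exact: le_trans (infB_le _ _ Aq0) ((svalP q0).2 x).
  exists (exist _ (fun x => inf (B x)) (conj sB Bp)) => s As.
  by apply/asboolP => x; exact: infB_le.
exists q; split=> // q' sq' q'q.
have q'p x : q' x <= p x by exact: le_trans (q'q x) (qp x).
have E : exist _ q' (conj sq' q'p) = exist _ q (conj sq qp) :> T.
  by apply: qmin; exact/asboolP.
exact: (congr1 sval E).
Qed.

Theorem hahn_banach p : sublinear p ->
  exists f : V -> R, linear (f : V -> R^o) /\ forall x, f x <= p x.
Proof.
move=> /minimal_sublinear_ex[q [sq qp qmin]].
by exists q; split=> //; exact: minimal_sublinear_linear.
Qed.

End hahn_banach.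

(** * Functionals that attain their norm at a given point *)

Section dual_lemmas.
Context {R : realType} {X : normedModType R}.

Lemma dual_of_bounded (l : X -> R^o) (M : R) : linear l ->
  (forall x, `|l x| <= M * `|x|) -> exists f : dual X, f =1 l.
Proof.
move=> linl lM; pose lL := GRing.isLinear.Build R X R^o _ l linl.
pose ll : {linear X -> R^o} := HB.pack l lL.
have contl : continuous l.
  apply: (@bounded_linear_continuous _ _ _ ll); apply/linear_boundedP.
  exists M; split=> [|K MK x]; first exact: num_real.
  by apply: (le_trans (lM x)); rewrite ler_wpM2r// ltW.
have lD : (l : X -> R^o) \in dual_pred by apply/asboolP.
by exists (Dual lD).
Qed.

(** Hahn-Banach is applied to the norm tilted at [x0]: lying below the norm bounds the functional by
    1, and the tilt at [- x0] forces its value at [x0] up to the norm. *)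
Lemma norming_functional (x0 : X) :
  exists f : dual X, `|f| <= 1 /\ f x0 = `|x0|.
Proof.
have sn : sublinear (fun x : X => `|x|).
  split=> [x y|a x a0]; first exact: ler_normD.
  by rewrite normrZ ger0_norm.
have [l [linl lle]] := hahn_banach (tilt_sublinear x0 sn).
have lN x : l (- x) = - l x.
  pose lL := GRing.isLinear.Build R X R^o _ l linl.
  pose ll : {linear X -> R^o} := HB.pack l lL.
  exact: (linearN ll).
have len x : l x <= `|x| by exact: le_trans (lle x) (tilt_le_self _ _ sn).
have lb x : `|l x| <= 1 * `|x|.
  by rewrite mul1r ler_norml len andbT -normrN lerNl -lN len.
have [f fl] := dual_of_bounded linl lb.
exists f; split; first by apply: dual_norm_le => // x; rewrite fl.
apply/eqP; rewrite fl eq_le len/= -lerN2 -lN.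
exact: le_trans (lle _) (tiltN_le _ sn).
Qed.

End dual_lemmas.

(** * Renorming by an equivalent inner product *)

Section semi_inner_product.
Context {R : realType} {V : lmodType R}.
Implicit Types (b : V -> V -> R) (x y : V).

(** Definiteness is left out because a frame operator directly yields only a nonnegative form; it
    follows later from a comparison with the norm. *)
Definition semi_inner_product b :=
  [/\ forall y, linear (b ^~ y : V -> R^o), forall x y, b x y = b y x
    & forall x, 0 <= b x x].

Variables (b : V -> V -> R) (bP : semi_inner_product b).

Lemma sipPl a x x' y : b (a *: x + x') y = a * b x y + b x' y.
Proof. by case: bP => + _ _ => /(_ y a x x'). Qed.

Lemma sipC x y : b x y = b y x.
Proof. by case: bP. Qed.

Lemma sip_ge0 x : 0 <= b x x.
Proof. by case: bP. Qed.

Lemma sipPr a x x' y : b y (a *: x + x') = a * b y x + b y x'.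
Proof. by rewrite sipC sipPl !(sipC _ y). Qed.

Lemma sip0l x : b 0 x = 0.
Proof.
have := sipPl 1 0 0 x; rewrite scale1r addr0 mul1r => /eqP.
by rewrite -subr_eq0 opprD addNKr oppr_eq0 => /eqP.
Qed.

Lemma sipZl a x y : b (a *: x) y = a * b x y.
Proof. by rewrite -[a *: x]addr0 sipPl sip0l addr0. Qed.

Lemma sipZr a x y : b x (a *: y) = a * b x y.
Proof. by rewrite sipC sipZl sipC. Qed.

Lemma sipDl x x' y : b (x + x') y = b x y + b x' y.
Proof. by rewrite -[x]scale1r sipPl scale1r mul1r. Qed.

Lemma sipDr x x' y : b y (x + x') = b y x + b y x'.
Proof. by rewrite sipC sipDl !(sipC _ y). Qed.

Lemma sip_norm_comb a x y :
  b (a *: x + y) (a *: x + y) = a ^+ 2 * b x x + 2 * a * b x y + b y y.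
Proof. rewrite sipPl !sipPr (sipC y x); ring. Qed.

Lemma sip_CauchySchwarz x y : b x y ^+ 2 <= b x x * b y y.
Proof.
have [y0|y0] := eqVneq (b y y) 0.
  rewrite y0 mulr0; have [->|bxy] := eqVneq (b x y) 0; first by rewrite expr0n.
  (* With [b y y = 0] the form is affine in the coefficient of [y]; this coefficient would give it
     the value -1. *)
  have := sip_ge0 (- ((b x x + 1) / (2 * b x y)) *: y + x).
  rewrite sip_norm_comb y0 mulr0 add0r (sipC y x).
  rewrite (_ : 2 * _ * _ = - (b x x + 1)); first by lra.
  by field.
have {}y0 : 0 < b y y by rewrite lt_def y0 sip_ge0.
(* This coefficient of [y] minimizes the form. *)
have := sip_ge0 (- (b x y / b y y) *: y + x).
rewrite sip_norm_comb (sipC y x).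
rewrite (_ : _ + b x x = (b x x * b y y - b x y ^+ 2) / b y y).
  by rewrite pmulr_lge0 ?invr_gt0// subr_ge0.
by field; rewrite gt_eqF.
Qed.

Lemma sip_triangle x y :
  Num.sqrt (b (x + y) (x + y)) <= Num.sqrt (b x x) + Num.sqrt (b y y).
Proof.
rewrite -[leRHS]ger0_norm ?addr_ge0 ?sqrtr_ge0// -sqrtr_sqr ler_wsqrtr//.
rewrite sqrrD !sqr_sqrtr ?sip_ge0// -sqrtrM ?sip_ge0//.
rewrite sipDl !sipDr (sipC y x).
have : b x y <= Num.sqrt (b x x * b y y).
  apply: (le_trans (ler_norm _)).
  by rewrite -sqrtr_sqr ler_wsqrtr// sip_CauchySchwarz.
by rewrite -mulr_natr; lra.
Qed.

Lemma sip_sqrtZ a x :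
  Num.sqrt (b (a *: x) (a *: x)) = `|a| * Num.sqrt (b x x).
Proof. by rewrite sipZl sipZr mulrA -expr2 sqrtrM ?sqr_ge0// sqrtr_sqr. Qed.

End semi_inner_product.

(** * Replacing the norm by that of an inner product *)

Section renorming.
Context {R : realType}.

(** The lower bound [esip_lbP] also makes the form definite. The constants carry no sign condition,
    so absolute values are taken where positivity matters. *)
Record equivalent_sip (X : normedModType R) := EquivalentSip {
  esip :> X -> X -> R;
  esipP : semi_inner_product esip;
  esip_lb : R;
  esip_lbP : forall x, `|x| <= esip_lb * Num.sqrt (esip x x);
  esip_ub : R;
  esip_ubP : forall x, Num.sqrt (esip x x) <= esip_ub * `|x|
}.

(** An alias with [b] in its type, so that the same vectors can carry a second norm. *)
Definition renormed (X : normedModType R) (b : equivalent_sip X) : Type := X.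

HB.instance Definition _ X (b : equivalent_sip X) :=
  GRing.Lmodule.copy (renormed b) X.

Section renormed_norm.
Context {X : normedModType R} (b : equivalent_sip X).

Let nm (x : renormed b) : R := Num.sqrt (b x x).
Let nmD x y : nm (x + y) <= nm x + nm y.
Proof. exact: sip_triangle (esipP b) x y. Qed.
Let nmZ (a : R) x : nm (a *: x) = `|a| * nm x.
Proof. exact: sip_sqrtZ (esipP b) a x. Qed.
Let nm0 x : nm x = 0 -> x = 0.
Proof.
move=> x0; have := esip_lbP b x; rewrite -[Num.sqrt _]/(nm x) x0 mulr0.
by rewrite normr_le0 => /eqP.
Qed.

HB.instance Definition _ := Lmodule_isNormed.Build R (renormed b) nmD nmZ nm0.

Lemma renormed_normE (x : renormed b) : `|x| = Num.sqrt (b x x).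
Proof. by []. Qed.

Definition to_renormed (x : X) : renormed b := x.
Definition of_renormed (x : renormed b) : X := x.

Let to_linear : linear to_renormed. Proof. by []. Qed.
Let of_linear : linear of_renormed. Proof. by []. Qed.
HB.instance Definition _ :=
  GRing.isLinear.Build R X (renormed b) _ to_renormed to_linear.
HB.instance Definition _ :=
  GRing.isLinear.Build R (renormed b) X _ of_renormed of_linear.

End renormed_norm.

Lemma bounded_operator_continuous (V W : normedModType R)
  (T : {linear V -> W}) : bounded_operator T -> continuous T.
Proof.
move=> [M TM]; apply: bounded_linear_continuous; apply/linear_boundedP.
exists M; split=> [|K MK x]; first exact: num_real.
by apply: (le_trans (TM x)); rewrite ler_wpM2r// ltW.
Qed.

Lemma to_renormed_continuous (X : normedModType R) (b : equivalent_sip X) :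
  continuous (to_renormed b).
Proof.
by apply: bounded_operator_continuous; exists (esip_ub b); exact: esip_ubP.
Qed.

Lemma of_renormed_continuous (X : normedModType R) (b : equivalent_sip X) :
  continuous (@of_renormed X b).
Proof.
apply: bounded_operator_continuous; exists (esip_lb b) => x.
exact: (esip_lbP b x).
Qed.

Section renormed_complete.
Context {X : completeNormedModType R} (b : equivalent_sip X).

(** The lower bound makes a Cauchy filter for the new norm Cauchy for the old one; the upper bound
    brings the limit back. *)
Fact renormed_complete (F : set_system (renormed b)) :
  ProperFilter F -> cauchy F -> cvg F.
Proof.
move=> FF /cauchyP Fc.
have /cvg_ex[l Fl] : cvg (of_renormed x @[x --> F]).
  apply: cauchy_cvg; apply/cauchyP => e e0.
  have c0 : 0 < `|esip_lb b| + 1 by rewrite ltr_wpDl.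
  have [x Fx] := Fc _ (divr_gt0 e0 c0); exists (of_renormed x).
  rewrite /=; apply: filterS Fx => y; rewrite -!ball_normE /= => xy.
  apply: (le_lt_trans (esip_lbP b (of_renormed x - of_renormed y))).
  rewrite -[Num.sqrt _]/(`|x - y|).
  move: xy; rewrite ltr_pdivlMr// mulrC; apply: le_lt_trans.
  by rewrite ler_wpM2r// (le_trans (ler_norm _))// lerDl.
apply/cvg_ex; exists (to_renormed b l).
by move=> P /(continuous_cvg _ (@to_renormed_continuous _ b l) Fl).
Qed.

HB.instance Definition _ :=
  Uniform_isComplete.Build (renormed b) renormed_complete.

End renormed_complete.

Lemma hilbert_renormed (X : completeNormedModType R) (b : equivalent_sip X) :
  hilbert (renormed b).
Proof.
pose f (x y : renormed b) : R := b x y.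
have fbil : bilinear_for *%R (idfun \; *%R) f.
  split=> [y a x x'|y a x x'].
    exact: (sipPl (esipP b)).
  exact: (sipPr (esipP b)).
have fherm x y : f x y = (-1) ^+ false * idfun (f y x).
  by rewrite expr0 mul1r; exact: (sipC (esipP b)).
have fpos x : x != 0 -> 0 < f x x.
  by rewrite -normr_gt0 renormed_normE sqrtr_gt0.
pose f1 := bilinear_isBilinear.Build _ _ _ _ _ _ f fbil.
pose f2 := isHermitianSesquilinear.Build _ _ false idfun f fherm.
pose f3 := isDotProduct.Build _ _ f fpos.
pose fd : {dot (renormed b) for idfun} := HB.pack f f1 f2 f3.
by exists fd => x; rewrite renormed_normE sqr_sqrtr ?(sip_ge0 (esipP b)).
Qed.

Lemma isomorphic_renormed (X : completeNormedModType R) (b : equivalent_sip X) :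
  exists H : completeNormedModType R, hilbert H /\ isomorphic X H.
Proof.
exists (renormed b); split; first exact: hilbert_renormed.
exists (to_renormed b), (@of_renormed X b); split=> //.
- exact: to_renormed_continuous.
- exact: of_renormed_continuous.
Qed.

End renorming.

(** * From frames to an inner product *)

Section frames.
Context {R : realType}.
Implicit Type N : option nat.

(* Indices of the [k]-th partial sum; for a finite index set, every partial sum
   is the whole sum, so that both kinds of frames are limits over [k]. *)
Definition frame_indices N (k : nat) : seq (index_set N) :=
  match N with Some n => index_enum 'I_n | None => index_iota 0 k end.

Lemma sums_to_cvg (Z : normedModType R) N (u : index_set N -> Z) (z : Z) :
  sums_to u z -> \sum_(i <- frame_indices N k) u i @[k --> \oo] --> z.
Proof. by case: N u => [n|] u //= <-; exact: cvg_cst. Qed.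

Lemma dual_bound (X : normedModType R) (f : dual X) x : `|f x| <= `|f| * `|x|.
Proof. exact: ler_dual_norm. Qed.

Lemma dual_sumE (X : normedModType R) I (r : seq I) (f : I -> dual X) x :
  (\sum_(i <- r) f i) x = \sum_(i <- r) f i x.
Proof.
exact: (big_morph (fun g : dual X => g x) (fun g h => dualDE g h x) (erefl _)).
Qed.

Lemma linear_span_sum (Z : normedModType R) (A : set Z) I (r : seq I)
  (a : I -> R) (u : I -> Z) :
  (forall i, A (u i)) -> linear_span A (\sum_(i <- r) a i *: u i).
Proof.
move=> Au; elim: r => [|i r ihr].
  by rewrite big_nil; exists [::]; rewrite big_nil.
rewrite big_cons; apply: linear_spanP => //.
exists [:: (1, u i)]; rewrite big_seq1 scale1r; split=> //.
by move=> p; rewrite inE => /eqP ->; exact: Au.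
Qed.

Lemma bounded_operator_gt0 (V W : normedModType R) (T : V -> W) :
  bounded_operator T -> exists2 M, 0 < M & forall x, `|T x| <= M * `|x|.
Proof.
move=> [M TM]; exists (`|M| + 1) => [|x]; first by rewrite ltr_wpDl.
by rewrite (le_trans (TM x))// ler_wpM2r// (le_trans (ler_norm _))// lerDl.
Qed.

(** * Uniform boundedness of the partial sums of a frame *)

Section partial_sums.
Context {Z : completeNormedModType R} {N : option nat}.
Variables (z : index_set N -> Z) (g : index_set N -> dual Z).
Hypothesis zg : schauder_frame z g.

Definition frame_sum k (x : Z) : Z :=
  \sum_(i <- frame_indices N k) g i x *: z i.

Lemma frame_sum_cvg x : frame_sum k x @[k --> \oo] --> x.
Proof. exact: sums_to_cvg. Qed.

Lemma frame_sum_cvg_dual (f : dual Z) x :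
  \sum_(i <- frame_indices N k) g i x * f (z i) @[k --> \oo] --> (f x : R^o).
Proof.
have -> : (fun k => \sum_(i <- frame_indices N k) g i x * f (z i)) =
    f \o frame_sum ^~ x.
  apply/funext => k; rewrite /= /frame_sum linear_sum; apply: eq_bigr => i _.
  by rewrite linearZ.
exact: (continuous_cvg _ (@dual_continuous _ _ f x) (@frame_sum_cvg x)).
Qed.

Lemma frame_sum_linear k : linear (frame_sum k).
Proof.
move=> a x y; rewrite /frame_sum scaler_sumr -big_split; apply: eq_bigr => i _.
by rewrite linearP scalerDl scalerA.
Qed.

Lemma frame_sum_cvg_bounded (l : Z -> R^o) (M : R) x : linear l ->
  (forall x, `|l x| <= M * `|x|) ->
  \sum_(i <- frame_indices N k) g i x * l (z i) @[k --> \oo] --> l x.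
Proof.
by move=> ll lM; have [f /funext <-] := dual_of_bounded ll lM;
  exact: frame_sum_cvg_dual.
Qed.

Lemma frame_sum_bounded : exists C, forall k x, `|frame_sum k x| <= C * `|x|.
Proof.
have lin k := frame_sum_linear k.
pose F := range frame_sum.
have [] := @Banach_Steinhauss R Z Z F _ _ 1.
- move=> _ [k _ <-]; split; last exact: lin.
  (* A crude bound depending on [k]; uniformity in [k] comes only from Banach-Steinhaus and
     pointwise convergence. *)
  move=> r; pose B := \sum_(i <- frame_indices N k) `|g i| * `|z i|.
  exists (B * r) => x xr; rewrite mulr_suml.
  rewrite (le_trans (ler_norm_sum _ _ _))//; apply: ler_sum => i _.
  rewrite normrZ mulrAC ler_wpM2r//.
  by rewrite (le_trans (dual_bound _ _))// ler_wpM2l.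
- move=> x; have /cvg_seq_bounded[M [_ Mb]] : cvgn (frame_sum ^~ x).
    by apply/cvg_ex; exists x; exact: @frame_sum_cvg.
  exists (M + 1) => _ [k _ <-]; apply: (Mb (M + 1)) => //.
  by rewrite ltrDl.
- move=> M Mb; exists M => k x.
  have [->|x0] := eqVneq x 0.
    rewrite /frame_sum big1 ?normr0 ?mulr0// => i _.
    by rewrite linear0 scale0r.
  have nx0 : 0 < `|x| by rewrite normr_gt0.
  pose fL := GRing.isLinear.Build R Z Z _ (frame_sum k) (lin k).
  pose f : {linear Z -> Z} := HB.pack (frame_sum k) fL.
  have := Mb (frame_sum k) (ex_intro2 _ _ k I erefl) (`|x|^-1 *: x).
  rewrite normrZ normfV normr_id mulVf ?gt_eqF// => /(_ (lexx _)).
  rewrite -[frame_sum k (_ *: _)]/(f (_ *: _)) linearZ normrZ normfV normr_id.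
  by rewrite ler_pdivrMl// mulrC.
Qed.

End partial_sums.

(** The partial sums in [TE] are symmetric and, on the diagonal, sums of squares; both properties
    pass to the limit. *)
Lemma HS_frame_sip (Z : completeNormedModType R) N (z : index_set N -> Z)
  (T : {linear Z -> dual Z}) :
  HS_frame_with z T -> semi_inner_product (fun x y => T x y).
Proof.
move=> [[M TM] zT].
have Tl y : linear ((fun x => T x y) : Z -> R^o).
  by move=> a x x'; rewrite linearP dualDE dualZE.
have TE x y : \sum_(i <- frame_indices N k) T (z i) x * T (z i) y @[k --> \oo]
    --> (T x y : R^o).
  apply: (frame_sum_cvg_bounded zT (Tl y) (M := M * `|y|)) => x'.
  by rewrite (le_trans (dual_bound _ _))// mulrAC ler_wpM2r.
split=> [||x]; first exact: Tl.
  move=> x y; apply: (cvg_unique _ (TE x y)) => //.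
  apply: cvg_trans (TE y x); apply: near_eq_cvg; apply: nearW => k.
  by apply: eq_bigr => i _; rewrite mulrC.
rewrite -(cvg_lim _ (TE x x))//; apply: limr_ge.
  by apply/cvg_ex; exists (T x x); exact: TE.
by apply: nearW => k; apply: sumr_ge0 => i _; rewrite -expr2 sqr_ge0.
Qed.

End frames.

(** * The inner product determined by the two frames *)

Section renorming_from_frames.
Context {R : realType} {X : completeNormedModType R} {N : option nat}.
Variables (x : index_set N -> X) (S : {linear X -> dual X}).
Hypothesis xS : HS_frame_with x S.

Let Y := closed_span (range (S \o x)).
Let y : index_set N -> Y := in_closed_span (S \o x).

Variable T : {linear Y -> dual Y}.
Hypothesis yT : HS_frame_with y T.

(** [S] sends the partial sums of [w] into the linear span and is continuous. Hence [S] can be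
    viewed as a map into [Y]. *)
Lemma HS_frame_range w : S w \in closed_span_pred (range (S \o x)).
Proof.
rewrite !inE.
have c := continuous_cvg _ (@bounded_operator_continuous _ _ _ S xS.1 w)
  (frame_sum_cvg (x := w) xS.2).
apply: (closed_cvg _ _ _ _ (c _)); first exact: closed_closure.
apply: nearW => k; apply: subset_closure.
rewrite /= /frame_sum linear_sum.
under eq_bigr do rewrite linearZ.
by apply: linear_span_sum => i; exists i.
Qed.

Let S' w : Y := ClosedSpan (HS_frame_range w).

Let S'x i : S' (x i) = y i.
Proof. exact: val_inj. Qed.

(* Expand [w] along the frame of [X], and [v] along that of [Y]. *)
Lemma HS_frame_range_dual (v : Y) w : T v (S' w) = val v w.
Proof.
have [[M SM] xSf] := xS.
have lf : linear ((fun w => T v (S' w)) : X -> R^o).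
  move=> a u u'; rewrite -linearP; congr (T v _); apply: val_inj.
  by rewrite /= linearP.
have fM u : `|T v (S' u)| <= `|T v| * M * `|u|.
  by rewrite (le_trans (dual_bound _ _))// -mulrA ler_wpM2l//; exact: SM.
have lh : linear ((fun v : Y => val v w) : Y -> R^o).
  by move=> a u u'; exact: (etrans (dualDE (a *: val u) (val u') w)).
have hM (u : Y) : `|val u w| <= `|w| * `|u|.
  by rewrite mulrC; exact: dual_bound.
have h1 := frame_sum_cvg_bounded (x := w) xSf lf fM.
have h2 := frame_sum_cvg_bounded (x := v) yT.2 lh hM.
(* Both expansions have the same terms, by symmetry of the form of [T]. *)
apply: cvg_unique h1 _ => //; apply: cvg_trans h2.
apply: near_eq_cvg; apply: nearW => k; apply: eq_bigr => i _ /=.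
by rewrite mulrC S'x (sipC (HS_frame_sip yT) v).
Qed.

Lemma HS_frame_bounded_below : exists K, forall w, `|w| <= K * `|S w|.
Proof.
have [C xC] := frame_sum_bounded xS.2.
have [M M0 TM] := bounded_operator_gt0 yT.1.
exists (M * `|C|) => w.
have [phi [phi1 <-]] := norming_functional w.
have cphi : phi (frame_sum x (S \o x) k w) @[k --> \oo] --> (phi w : R^o).
  exact: (continuous_cvg _ (@dual_continuous _ _ phi w)
    (frame_sum_cvg (x := w) xS.2)).
rewrite -(cvg_lim _ cphi)//; apply: limr_le.
  by apply/cvg_ex; eexists; exact: cphi.
apply: nearW => k.
(* This is [phi] composed with the partial sum operator: a finite combination of the [y i], hence in
   [Y] even if [phi] is not. *)
pose v : Y := \sum_(i <- frame_indices N k) phi (x i) *: y i.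
have vE u : val v u = phi (frame_sum x (S \o x) k u).
  rewrite /v raddf_sum dual_sumE linear_sum; apply: eq_bigr => i _.
  by rewrite linearZ [RHS]mulrC; exact: (dualZE (phi (x i)) (S (x i)) u).
have nv : `|v| <= `|C|.
  apply: dual_norm_le => // u; rewrite vE.
  apply: (le_trans (dual_bound _ _)).
  apply: (@le_trans _ _ (1 * (`|C| * `|u|))); last by rewrite mul1r.
  apply: ler_pM => //.
  by rewrite (le_trans (xC k u))// ler_wpM2r// ler_norm.
rewrite -[phi _]vE -HS_frame_range_dual (le_trans (ler_norm _))//.
apply: (le_trans (dual_bound _ _)); apply: ler_pM => //.
by rewrite (le_trans (TM v))// ler_wpM2l// ltW.
Qed.

Lemma HS_frames_hilbert :
  exists H : completeNormedModType R, hilbert H /\ isomorphic X H.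
Proof.
have [M M0 SM] := bounded_operator_gt0 xS.1.
have [K SK] := HS_frame_bounded_below.
have sip := HS_frame_sip xS.
have ub w : Num.sqrt (S w w) <= Num.sqrt M * `|w|.
  rewrite -[`|w|]ger0_norm// -sqrtr_sqr -sqrtrM ?(ltW M0)// ler_wsqrtr//.
  rewrite (le_trans (ler_norm _))// (le_trans (dual_bound _ _))//.
  by rewrite expr2 mulrA ler_wpM2r//; exact: SM.
(* Cauchy-Schwarz bounds [S w u] by the product of the two seminorms, and [ub] controls the one of
   [u]. *)
have Sub w : `|S w| <= Num.sqrt M * Num.sqrt (S w w).
  apply: dual_norm_le => [|u]; first by rewrite mulr_ge0// sqrtr_ge0.
  rewrite mulrAC; apply: (@le_trans _ _ (Num.sqrt (S u u) * Num.sqrt (S w w))).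
    rewrite -sqrtrM ?(sip_ge0 sip)// -sqrtr_sqr ler_wsqrtr// mulrC.
    exact: (sip_CauchySchwarz sip).
  by rewrite ler_wpM2r ?sqrtr_ge0.
have lb w : `|w| <= (`|K| * Num.sqrt M) * Num.sqrt (S w w).
  rewrite -mulrA (le_trans (SK w))//.
  apply: (@le_trans _ _ (`|K| * `|S w|)); first by rewrite ler_wpM2r// ler_norm.
  by rewrite ler_wpM2l.
exact: isomorphic_renormed (EquivalentSip sip lb ub).
Qed.

End renorming_from_frames.

(** * From an inner product to frames *)

Section operators.
Context {R : realType}.

Lemma continuous_linear_bounded (V W : normedModType R) (T : {linear V -> W}) :
  continuous T -> exists2 M : R, 0 < M & forall x, `|T x| <= M * `|x|.
Proof.
move=> cT.
have /linear_boundedP/pinfty_ex_gt0[M M0 TM] : bounded_near T (nbhs 0).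
  by apply/linear_bounded_continuous.
by exists M.
Qed.

(** The lower bound on [T] makes preimages of a sequence tending to [w] Cauchy; completeness of [V]
    gives a limit, which [T] maps to [w]. *)
Lemma closed_range (V : completeNormedModType R) (W : normedModType R)
  (T : {linear V -> W}) (K : R) :
  continuous T -> (forall x, `|x| <= K * `|T x|) ->
  closure (range T) `<=` range T.
Proof.
move=> cT TK w /closure_normP wT.
have inv_gt0 (n : nat) : 0 < n.+1%:R^-1 :> R by rewrite invr_gt0.
have /choice[x xw] : forall n, exists x, `|w - T x| < n.+1%:R^-1.
  by move=> n; have [_ [x _ <-]] := wT _ (inv_gt0 n); exists x.
have K0 : 0 < `|K| + 1 by rewrite ltr_wpDl.
have TK' u : `|u| <= (`|K| + 1) * `|T u|.
  rewrite (le_trans (TK u))// ler_wpM2r// (le_trans (ler_norm _))//.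
  by rewrite lerDl.
have /cvg_ex[l xl] : cvgn x.
  apply: cauchy_cvg; apply/cauchyP => e e0.
  have d0 : 0 < e / (`|K| + 1) / 2 by rewrite !divr_gt0.
  have [n _ nd] := near_infty_natSinv_lt (PosNum d0).
  exists (x n); exists n => // m /= nm; rewrite -ball_normE /=.
  rewrite (le_lt_trans (TK' _))// mulrC -ltr_pdivlMr// linearB.
  rewrite -[_ - _](subrKA w) (splitr (e / _)) (le_lt_trans (ler_normD _ _))//.
  rewrite distrC; apply: ltrD.
    exact: lt_trans (xw n) (nd n (leqnn n)).
  exact: lt_trans (xw m) (nd m nm).
exists l => //.
have Txl : T (x n) @[n --> \oo] --> T l.
  exact: (continuous_cvg _ (cT l) xl).
apply: cvg_unique Txl _ => //; apply/cvgrPdist_lt => e e0.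
near=> n; apply: lt_trans (xw n) _; near: n.
exact: near_infty_natSinv_lt (PosNum e0).
Unshelve. all: by end_near. Qed.

(** The Riesz map of a bounded form; it supplies the frame operators of both [X] and the closed
    span. *)
Lemma sip_operator (Z : normedModType R) (b : Z -> Z -> R) (M : R) :
  semi_inner_product b -> (forall x y, `|b x y| <= M * `|x| * `|y|) ->
  exists S : {linear Z -> dual Z},
    bounded_operator S /\ forall x y, S x y = b x y.
Proof.
move=> sb bM.
have /choice[S SE] x : exists f : dual Z, forall y, f y = b x y.
  apply: (@dual_of_bounded _ _ _ (M * `|x|)); last exact: bM.
  by move=> a u v; rewrite (sipPr sb).
have Sl : linear S.
  by move=> a u v; apply: dualP => w; rewrite dualDE dualZE !SE (sipPl sb).
pose SL := GRing.isLinear.Build R Z (dual Z) _ S Sl.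
exists (HB.pack S SL : {linear Z -> dual Z}); split=> //=.
exists `|M| => x; apply: dual_norm_le => [|y]; first by rewrite mulr_ge0.
rewrite SE (le_trans (bM x y))// -!mulrA ler_wpM2r ?mulr_ge0//.
exact: ler_norm.
Qed.

Lemma separable_dense_seq (Z : normedModType R) : separable Z ->
  exists d : nat -> Z, forall x e, 0 < e -> exists n, `|x - d n| < e.
Proof.
move=> [D /countable_injP[f finj] dD].
(* The term of index [n] is the element of [D] with code [n], or 0 if there is none. *)
exists (fun n => xget 0 [set x | D x /\ f x = n]) => x e e0.
have [] := dD (ball x e).
- by exists x; exact: ballxx.
- exact: ball_open.
move=> z [xz Dz]; exists (f z).
have [Dg fg] := xgetPex 0 (ex_intro _ z (conj Dz erefl) :
  exists y, [set y | D y /\ f y = f z] y).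
rewrite (finj _ _ _ _ fg) ?inE//.
by move: xz; rewrite -ball_normE.
Qed.

End operators.

(** * Orthonormal expansion obtained from a dense sequence *)

Section gram_schmidt.
Context {R : realType} {X : normedModType R}.
Variables (b : equivalent_sip X) (d : nat -> X).

Let bP := esipP b.

Let b_eq0 x : b x x = 0 -> x = 0.
Proof.
move=> bx; apply/eqP; rewrite -normr_le0 (le_trans (esip_lbP b x))//.
by rewrite bx sqrtr0 mulr0.
Qed.

Definition normalize (v : X) : X := (Num.sqrt (b v v))^-1 *: v.

(* [residual n] is the projection onto the orthogonal of [d 0], ..., [d n.-1];
   [gram_schmidt n] is zero when [d n] depends on the previous vectors. *)
Fixpoint residual n x : X :=
  if n is m.+1 then
    residual m x - b (normalize (residual m (d m))) (residual m x)
                   *: normalize (residual m (d m))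
  else x.

Definition gram_schmidt n : X := normalize (residual n (d n)).

Lemma residualS n x : residual n.+1 x =
  residual n x - b (gram_schmidt n) (residual n x) *: gram_schmidt n.
Proof. by []. Qed.

Lemma normalize0 : normalize 0 = 0.
Proof. by rewrite /normalize scaler0. Qed.

Lemma normalize_unit v : v != 0 -> b (normalize v) (normalize v) = 1.
Proof.
move=> v0; rewrite /normalize (sipZl bP) (sipZr bP) mulrA -expr2 exprVn.
rewrite sqr_sqrtr ?(sip_ge0 bP)// mulVf//.
by apply: contra_neq v0; exact: b_eq0.
Qed.

Lemma normalizeK v : b (normalize v) v *: normalize v = v.
Proof.
have [->|v0] := eqVneq v 0; first by rewrite normalize0 scaler0.
have bv : b v v != 0 by apply: contra_neq v0; exact: b_eq0.
rewrite /normalize (sipZl bP) scalerA mulrAC -expr2 exprVn.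
by rewrite sqr_sqrtr ?(sip_ge0 bP)// mulVf// scale1r.
Qed.

(** A substitute for normalization that covers unit vectors and zero vectors alike. *)
Lemma gram_schmidt_idem n w :
  b (gram_schmidt n) w * b (gram_schmidt n) (gram_schmidt n) =
  b (gram_schmidt n) w.
Proof.
rewrite /gram_schmidt; have [->|v0] := eqVneq (residual n (d n)) 0.
  by rewrite normalize0 !(sip0l bP) mulr0.
by rewrite normalize_unit// mulr1.
Qed.

Lemma residual_linear n : linear (residual n).
Proof.
move=> a x y; elim: n => [//|n ihn]; rewrite !residualS ihn (sipPr bP).
by rewrite scalerDl scalerBr -scalerA opprD addrACA.
Qed.

Lemma residual_eq0 n m : (m < n)%N -> residual n (d m) = 0.
Proof.
elim: n => // n ihn; rewrite ltnS leq_eqVlt => /predU1P[->|/ihn r0].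
  by rewrite residualS normalizeK subrr.
by rewrite residualS r0 (sipC bP) (sip0l bP) scale0r subrr.
Qed.

Lemma residual_orthogonal n k x : (k < n)%N ->
  b (gram_schmidt k) (residual n x) = 0.
Proof.
elim: n x => // n ihn x; rewrite ltnS leq_eqVlt => /predU1P[->|kn].
  rewrite residualS addrC -scaleNr (sipPr bP) mulNr gram_schmidt_idem.
  by rewrite addNr.
rewrite residualS addrC -scaleNr (sipPr bP) ihn// addr0 (sipZr bP).
by rewrite ihn// !mulr0.
Qed.

(** A form of Bessel's inequality: each stage lowers the form by the square of the removed
    coefficient. *)
Lemma residual_le n x : b (residual n x) (residual n x) <= b x x.
Proof.
elim: n => // n; apply: le_trans; rewrite residualS.
set e := gram_schmidt n; set u := residual n x.
rewrite addrC -scaleNr (sip_norm_comb bP) sqrrN expr2 -mulrA gram_schmidt_idem.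
by have := sqr_ge0 (b e u); rewrite expr2; lra.
Qed.

(** The recursion takes coefficients of residuals; they equal those of [x] because the vectors
    removed earlier are orthogonal to the new one. *)
Lemma residualE n x :
  residual n x = x - \sum_(0 <= k < n) b (gram_schmidt k) x *: gram_schmidt k.
Proof.
elim: n => [|n ihn]; first by rewrite big_nil subr0.
rewrite residualS big_nat_recr //= opprD addrA -ihn; congr (_ - _ *: _).
have b0 y : b y 0 = 0 by rewrite (sipC bP) (sip0l bP).
rewrite ihn (sipDr bP) -scaleN1r (sipZr bP).
rewrite (big_morph _ (fun u v => sipDr bP u v _) (b0 _)) big_nat.
rewrite big1 ?mulr0 ?addr0// => k /andP[_ kn].
rewrite (sipZr bP) (sipC bP (gram_schmidt n)) {3}/gram_schmidt /normalize.
by rewrite (sipZr bP) residual_orthogonal// !mulr0.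
Qed.

(** The error after [n] terms is the residual of [x]. For [n > m] the residual of [d m] vanishes, so
    [x] may be replaced by the small vector [x - d m], whose seminorm does not grow. *)
Lemma gram_schmidt_expansion (x : X) :
  (forall x e, 0 < e -> exists n, `|x - d n| < e) ->
  series (fun n => b (gram_schmidt n) x *: gram_schmidt n) @ \oo --> x.
Proof.
move=> dd; apply/cvgrPdist_lt => e e0.
(* The cost of passing from the norm to the form and back; adding 1 makes each factor positive. *)
pose K := (`|esip_lb b| + 1) * (`|esip_ub b| + 1).
have K0 : 0 < K by rewrite mulr_gt0// ltr_wpDl.
have leK (a t : R) : 0 <= t -> a * t <= (`|a| + 1) * t.
  by move=> t0; rewrite ler_wpM2r// (le_trans (ler_norm _))// lerDl.
have [m xm] := dd x _ (divr_gt0 e0 K0).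
exists m.+1 => // n /= mn; rewrite /series /= -residualE.
have -> : residual n x = residual n (x - d m).
  by rewrite -scaleN1r addrC residual_linear residual_eq0// scaler0 add0r.
apply: (@le_lt_trans _ _ (K * `|x - d m|)); last by rewrite mulrC -ltr_pdivlMr.
apply: (le_trans (esip_lbP b _)); apply: (le_trans (leK _ _ (sqrtr_ge0 _))).
rewrite /K -mulrA ler_wpM2l ?addr_ge0//.
apply: (le_trans (ler_wsqrtr (residual_le _ _))).
exact: le_trans (esip_ubP b _) (leK _ _ (normr_ge0 _)).
Qed.

End gram_schmidt.

(** * The frames of [X] and of the closed span *)

Section frames_from_sip.
Context {R : realType}.

Lemma equivalent_sip_of_hilbert (X H : completeNormedModType R) :
  hilbert H -> isomorphic X H -> inhabited (equivalent_sip X).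
Proof.
move=> [ip ipE] [f [g [fK gK cf cg]]].
have gl : linear g.
  by move=> a u v; apply: (can_inj fK); rewrite linearP !gK.
pose gL := GRing.isLinear.Build R H X _ g gl.
pose g' : {linear H -> X} := HB.pack g gL.
have [M _ fM] := continuous_linear_bounded cf.
have [K _ gM] := @continuous_linear_bounded _ _ _ g' cg.
have fE x : Num.sqrt (ip (f x) (f x)) = `|f x|.
  by rewrite -ipE sqrtr_sqr normr_id.
have lb x : `|x| <= K * Num.sqrt (ip (f x) (f x)).
  by rewrite fE -[in leLHS](fK x); exact: gM.
have ub x : Num.sqrt (ip (f x) (f x)) <= M * `|x| by rewrite fE.
have sip : semi_inner_product (fun x y => ip (f x) (f y)).
  split=> [y a u v|x y|x]; first by rewrite linearP linearPl.
    by rewrite (hermC ip) expr0 mul1r.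
  by rewrite -ipE sqr_ge0.
exact: (inhabits (EquivalentSip sip lb ub)).
Qed.

(** Zero vectors are harmless in a frame, so indexing by [nat] works in every dimension. *)
Lemma frames_of_equivalent_sip (X : completeNormedModType R)
  (b : equivalent_sip X) : separable X ->
  exists (x : nat -> X) (S : {linear X -> dual X}),
    HS_frame_with (x : index_set None -> X) S /\
    HS_frame (in_closed_span (S \o x) : index_set None -> _).
Proof.
move=> /separable_dense_seq[d dd]; pose e := gram_schmidt b d.
have bP := esipP b.
have eE x := gram_schmidt_expansion b (x := x) dd.
pose M := `|esip_ub b|; pose K := `|esip_lb b|.
have M0 : 0 <= M by exact: normr_ge0.
have K0 : 0 <= K by exact: normr_ge0.
have ub x : Num.sqrt (b x x) <= M * `|x|.
  by rewrite (le_trans (esip_ubP b x))// ler_wpM2r// ler_norm.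
have lb x : `|x| <= K * Num.sqrt (b x x).
  by rewrite (le_trans (esip_lbP b x))// ler_wpM2r ?sqrtr_ge0// ler_norm.
have bM x y : `|b x y| <= M ^+ 2 * `|x| * `|y|.
  rewrite -sqrtr_sqr (le_trans (ler_wsqrtr (sip_CauchySchwarz bP _ _)))//.
  rewrite sqrtrM ?(sip_ge0 bP)//.
  rewrite (_ : _ * _ * _ = M * `|x| * (M * `|y|)); last by ring.
  by apply: ler_pM; rewrite ?sqrtr_ge0.
have [S [SM SE]] := sip_operator bP bM.
have cS := bounded_operator_continuous SM.
(* The squared norm is at most [K ^+ 2 * S x x], hence at most [K ^+ 2] times the norms of [S x] and
   [x]; one factor cancels. *)
have SK x : `|x| <= K ^+ 2 * `|S x|.
  have [->|x0] := eqVneq x 0; first by rewrite normr0 mulr_ge0 ?sqr_ge0.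
  rewrite -(@ler_pM2r _ `|x|) ?normr_gt0// -mulrA -expr2.
  apply: (@le_trans _ _ (K ^+ 2 * b x x)).
    have := lb x; rewrite -ler_sqr ?nnegrE ?mulr_ge0 ?sqrtr_ge0//.
    by rewrite exprMn sqr_sqrtr ?(sip_ge0 bP).
  by rewrite ler_wpM2l ?sqr_ge0// -SE (le_trans (ler_norm _))// dual_bound.
have Sinj : injective S.
  move=> u v Suv; apply/eqP; rewrite -subr_eq0 -normr_le0.
  by rewrite (le_trans (SK _))// linearB Suv subrr normr0 mulr0.
exists e, S; split.
  split=> // x /=.
  have := eE x; congr (series _ @ \oo --> x).
  by apply/funext => n /=; rewrite SE.
pose Y := closed_span (range (S \o e)).
pose z : nat -> Y := in_closed_span (S \o e).
(* Since [S] has closed range, the closed span stays inside it, and [r] below inverts [S] there. *)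
have YS (y : Y) : exists x, S x = val y.
  have : closure (range S) (val y).
    have := closed_span_valP y; rewrite !inE; apply: closureS.
    move=> _ [s [sS ->]]; rewrite big_seq; apply: (big_ind (range S)).
    - by exists 0; rewrite // linear0.
    - by move=> _ _ [u _ <-] [v _ <-]; exists (u + v); rewrite // linearD.
    - by move=> p /sS[n _ <-]; exists (p.1 *: e n); rewrite // linearZ.
  by move=> /(closed_range cS SK)[x _ <-]; exists x.
have [r rE] := choice YS.
have rS (y : Y) x : S x = val y -> r y = x.
  by move=> Sx; apply: Sinj; rewrite rE.
have rl : linear r.
  by move=> a u v; apply: rS; rewrite linearP !rE.
pose c (u v : Y) := b (r u) (r v).
have cP : semi_inner_product c.
  split=> [y a u v|u v|u]; rewrite /c.
  - by rewrite rl (sipPl bP).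
  - exact: (sipC bP).
  - exact: (sip_ge0 bP).
have rM u : `|r u| <= K ^+ 2 * `|u|.
  by rewrite (le_trans (SK _))// rE.
have cM u v : `|c u v| <= M ^+ 2 * K ^+ 4 * `|u| * `|v|.
  rewrite (le_trans (bM _ _))// (_ : _ * _ * `|v| =
    M ^+ 2 * (K ^+ 2 * `|u|) * (K ^+ 2 * `|v|)); last by ring.
  apply: ler_pM; rewrite ?mulr_ge0 ?sqr_ge0//.
  by rewrite ler_wpM2l ?sqr_ge0.
have [T [TM TE]] := sip_operator cP cM.
exists T; split=> // y /=.
have Se : S (series (fun n => b (e n) (r y) *: e n) n) @[n --> \oo] --> val y.
  by rewrite -rE; exact: (continuous_cvg _ (cS (r y)) (eE (r y))).
apply/cvgrPdist_lt => eps eps0; near=> n.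
(* [S] maps the expansion of [r y] in [X] termwise to that of [y] in [Y], so the convergence in [X]
   carries over. *)
have -> : `|y - series (fun n => T (z n) y *: z n) n| =
          `|val y - S (series (fun n => b (e n) (r y) *: e n) n)|.
  rewrite closed_span_normE raddfB; congr (`|_ - _|).
  transitivity (\sum_(0 <= k < n) val (T (z k) y *: z k)).
    exact: raddf_sum.
  rewrite /series /= linear_sum; apply: eq_bigr => k _.
  have rz : r (z k) = e k by exact: rS.
  by rewrite [RHS]linearZ /= TE /c rz.
near: n; exact: (cvgrPdist_lt _ _).1 Se _ eps0.
Unshelve. all: by end_near. Qed.

End frames_from_sip.

Theorem theorem2p16 (R : realType) (X : completeNormedModType R) :
  separable X ->
  (exists H : completeNormedModType R, hilbert H /\ isomorphic X H)
  <->
  (exists (N : option nat) (x : index_set N -> X) (S : {linear X -> dual X}),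
     HS_frame_with x S /\ HS_frame (in_closed_span (S \o x))).
Proof.
move=> sepX; split=> [[H [hH iXH]]|[N [x [S [xS [T yT]]]]]].
  have [b] := equivalent_sip_of_hilbert hH iXH.
  by have [x [S xS]] := frames_of_equivalent_sip b sepX; exists None, x, S.
exact: HS_frames_hilbert xS T yT.
Qed.
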